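(* Let $(r_k)$ be a sequence of positive real numbers tending to infinity, $o_k\in\mathbf H^N$, $X_k=(\mathbf H^N,r_k^{-1}d,o_k)$, and let $X_\omega$ be the asymptotic cone of $(X_k)$ along a non-principal ultrafilter $\omega$ on $\mathbf N$. There are no metric space $Y$, sequence of isometric embeddings $f_k:X_k\to Y$ ($k\in\mathbf N$) and isometric embedding $f:X_\omega\to Y$ such that both: - for every sequence $(x_k)$ with $x_k\in X_k$ representing a point $[(x_k)]$ of $X_\omega$, the limit (along $\omega$) of the sequence $f_k(x_k)$ equals $f([(x_k)])$; - $f_k(X_k)$ converges (along $\omega$), in the Hausdorff topology of subsets of $Y$, to $f(X_\omega)$.
   Context: $N$ is a positive integer and $(\mathbf H^N,d)$ is the real hyperbolic space of dimension $N$. The asymptotic cone $X_\omega$ is the set of sequences $(x_k)$, $x_k\in X_k$, with $\omega\text{-}\lim r_k^{-1}d(x_k,o_k)<\infty$, modulo $(x_k)\sim(y_k)$ iff $\omega\text{-}\lim r_k^{-1}d(x_k,y_k)=0$, with the metric $d_\omega([(x_k)],[(y_k)])=\omega\text{-}\lim r_k^{-1}d(x_k,y_k)$; here $\omega\text{-}\lim$ denotes the limit along $\omega$. An isometric embedding is a distance-preserving map. Convergence in the Hausdorff topology means that the Hausdorff distance in $Y$ between $f_k(X_k)$ and $f(X_\omega)$ tends to $0$.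
   Formalization: The formal statement assumes N ≥ 2 instead of N positive: for N = 1 the claim is false, since H^1 is isometric to the real line and Y = R with f_k(x) = (x − o_k)/r_k satisfies both conditions. *)

(* Defs.v *)
From HB Require Import structures.
From mathcomp Require Import all_boot all_order all_algebra.
From mathcomp Require Import generic_quotient ring lra.
From mathcomp Require Import all_classical all_reals all_analysis.
Set Implicit Arguments.
Unset Strict Implicit.
Unset Printing Implicit Defensive.
Import Order.TTheory GRing.Theory Num.Theory.
Import numFieldNormedType.Exports.
Local Open Scope classical_set_scope.
Local Open Scope ring_scope.
Local Open Scope quotient_scope.

Section metric_spaces.
Context {R : realType}.

Definition isometric_embedding (S T : metricType R) (f : S -> T) :=
  forall x y, mdist (f x) (f y) = mdist x y.

Definition dist_to_set (Y : metricType R) (B : set Y) (a : Y) : \bar R :=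
  ereal_inf [set (mdist a b)%:E | b in B].

Definition hausdorff_dist (Y : metricType R) (A B : set Y) : \bar R :=
  Order.max (ereal_sup [set dist_to_set B a | a in A])
            (ereal_sup [set dist_to_set A b | b in B]).

End metric_spaces.

(** The metric space (T, c d), for (T, d) a metric space and c > 0. *)
Definition rescaled (R : realType) (c : {posnum R}) (T : metricType R) : Type :=
  T.

Section rescaled_metric.
Context {R : realType} (c : {posnum R}) (T : metricType R).

Definition rescaled_dist (x y : rescaled c T) : R :=
  c%:num * mdist (x : T) (y : T).

Lemma rescaled_distxx x : rescaled_dist x x = 0.
Proof. by rewrite /rescaled_dist mdistxx mulr0. Qed.

Lemma rescaled_dist_positivity x y : rescaled_dist x y = 0 -> x = y.
Proof.
by move/eqP; rewrite mulf_eq0 gt_eqF//= => /eqP; exact: mdist_positivity.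
Qed.

Lemma rescaled_dist_sym x y : rescaled_dist x y = rescaled_dist y x.
Proof. by rewrite /rescaled_dist metric_sym. Qed.

Lemma rescaled_dist_triangle y x z :
  rescaled_dist x z <= rescaled_dist x y + rescaled_dist y z.
Proof. by rewrite -mulrDr ler_pM2l// metric_triangle. Qed.

HB.instance Definition _ := Choice.copy (rescaled c T) T.
HB.instance Definition _ := isMetric.Build R (rescaled c T)
  rescaled_distxx rescaled_dist_positivity rescaled_dist_sym
  rescaled_dist_triangle.

End rescaled_metric.

(** Real hyperbolic space: the upper sheet of the two-sheeted hyperboloid in
    Minkowski space R^(1,N), with cosh (d(x, y)) = - <x, y>. *)
Section hyperboloid.
Context {R : realType}.

Definition spatial N (x y : 'rV[R]_N.+1) : R :=
  \sum_(i < N) x 0 (lift ord0 i) * y 0 (lift ord0 i).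

Definition minkowski N (x y : 'rV[R]_N.+1) : R :=
  spatial x y - x 0 0 * y 0 0.

Definition arcosh (t : R) : R := ln (t + Num.sqrt (t ^+ 2 - 1)).

Lemma discriminant_le (a b c : R) :
  (forall l, 0 <= a + 2 * l * b + l ^+ 2 * c) -> b ^+ 2 <= a * c.
Proof.
move=> H.
have c0 : 0 <= c.
  rewrite leNgt; apply/negP => c0.
  have a0 : 0 <= a by have := H 0; nra.
  pose l := (1 + a + `|b|) / - c + 1.
  have cl : l * - c = 1 + a + `|b| - c.
    by rewrite /l mulrDl mul1r divfK// oppr_eq0 lt_eqF.
  have l1 : 1 <= l.
    rewrite lerDr divr_ge0//; last by rewrite oppr_ge0 ltW.
    by rewrite !addr_ge0.
  have := H l; have := H (- l).
  have := normr_ge0 b.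
  nra.
have [c00|cn0] := eqVneq c 0.
  rewrite c00 mulr0; have [->|bn0] := eqVneq b 0; first by rewrite expr0n.
  have := H (- (a + 1) / (2 * b)); rewrite c00 mulr0 addr0.
  have -> : 2 * (- (a + 1) / (2 * b)) * b = - (a + 1) by field.
  by lra.
have := H (- b / c).
have -> : a + 2 * (- b / c) * b + (- b / c) ^+ 2 * c = (a * c - b ^+ 2) / c.
  by field.
by rewrite pmulr_lge0 ?subr_ge0// invr_gt0 lt_neqAle eq_sym cn0.
Qed.

Section forms.
Context {N : nat}.
Implicit Types x y z : 'rV[R]_N.+1.

Lemma spatialC x y : spatial x y = spatial y x.
Proof. by apply: eq_bigr => i _; rewrite mulrC. Qed.

Lemma spatialDl x y z l : spatial (x + l *: y) z = spatial x z + l * spatial y z.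
Proof.
by rewrite /spatial mulr_sumr -big_split/=; apply: eq_bigr => i _; rewrite !mxE; ring.
Qed.

Lemma spatialDr x y z l : spatial z (x + l *: y) = spatial z x + l * spatial z y.
Proof. by rewrite spatialC spatialDl !(spatialC z). Qed.

Lemma spatial_ge0 x : 0 <= spatial x x.
Proof. by apply: sumr_ge0 => i _; rewrite -expr2 sqr_ge0. Qed.

Lemma spatial_CS x y : spatial x y ^+ 2 <= spatial x x * spatial y y.
Proof.
apply: discriminant_le => l.
have := spatial_ge0 (x + l *: y); rewrite spatialDl !spatialDr (spatialC y x).
by congr (0 <= _); ring.
Qed.

Lemma minkowskiC x y : minkowski x y = minkowski y x.
Proof. by rewrite /minkowski spatialC mulrC. Qed.

Lemma minkowskiDl x y z l :
  minkowski (x + l *: y) z = minkowski x z + l * minkowski y z.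
Proof. by rewrite /minkowski spatialDl !mxE; ring. Qed.

Lemma minkowskiDr x y z l :
  minkowski z (x + l *: y) = minkowski z x + l * minkowski z y.
Proof. by rewrite minkowskiC minkowskiDl !(minkowskiC z). Qed.

Lemma minkowski_orth y v : minkowski y y = -1 -> minkowski v y = 0 ->
  spatial v v <= y 0 0 ^+ 2 * minkowski v v.
Proof.
rewrite /minkowski => yy vy; have := spatial_CS v y.
have -> : spatial v y = v 0 0 * y 0 0 by lra.
have -> : spatial y y = y 0 0 * y 0 0 - 1 by lra.
nra.
Qed.

Lemma minkowski_orth_ge0 y v : minkowski y y = -1 -> minkowski v y = 0 ->
  0 <= minkowski v v.
Proof.
move=> yy vy; have := minkowski_orth yy vy; have := spatial_ge0 v.
have : 0 < y 0 0 ^+ 2.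
  by have := spatial_ge0 y; rewrite /minkowski in yy; nra.
nra.
Qed.

Lemma minkowski_orth_eq0 y v : minkowski y y = -1 -> minkowski v y = 0 ->
  minkowski v v = 0 -> v = 0.
Proof.
move=> yy vy vv; have := minkowski_orth yy vy; rewrite vv mulr0 => sv.
have sv0 : spatial v v = 0 by apply/eqP; rewrite eq_le sv spatial_ge0.
have v00 : v 0 0 = 0.
  by apply/eqP; move: vv; rewrite /minkowski sv0 sub0r => /eqP;
     rewrite oppr_eq0 mulf_eq0 orbb.
apply/rowP => i; rewrite mxE; case: (unliftP ord0 i) => [j ->|->//].
move/eqP: sv0; rewrite psumr_eq0 => [|k _]; last by rewrite -expr2 sqr_ge0.
by move/allP/(_ j (mem_index_enum _)) => /=; rewrite mulf_eq0 orbb => /eqP.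
Qed.

End forms.

Lemma arcosh1 : arcosh 1 = 0.
Proof. by rewrite /arcosh expr1n subrr sqrtr0 addr0 ln1. Qed.

Lemma arcosh_eq0 t : 1 <= t -> arcosh t = 0 -> t = 1.
Proof.
move=> t1; have s0 := sqrtr_ge0 (t ^+ 2 - 1).
have p0 : 0 < t + Num.sqrt (t ^+ 2 - 1) by lra.
by move/eqP; rewrite ln_eq0// => /eqP; lra.
Qed.

Lemma arcosh_le s t : 1 <= s -> s <= t -> arcosh s <= arcosh t.
Proof.
move=> s1 st; have s0 := sqrtr_ge0 (s ^+ 2 - 1).
have t0 := sqrtr_ge0 (t ^+ 2 - 1).
rewrite /arcosh ler_ln ?posrE; try lra.
by rewrite lerD// ler_wsqrtr// lerB// !expr2; nra.
Qed.

Lemma arcoshD s t : 1 <= s -> 1 <= t -> arcosh s + arcosh t =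
  arcosh (s * t + Num.sqrt (s ^+ 2 - 1) * Num.sqrt (t ^+ 2 - 1)).
Proof.
move=> s1 t1; have s2 : 0 <= s ^+ 2 - 1 by nra.
have t2 : 0 <= t ^+ 2 - 1 by nra.
rewrite /arcosh; have := sqr_sqrtr s2; have := sqr_sqrtr t2.
have := sqrtr_ge0 (s ^+ 2 - 1); have := sqrtr_ge0 (t ^+ 2 - 1).
set a := Num.sqrt (s ^+ 2 - 1); set b := Num.sqrt (t ^+ 2 - 1).
move=> b0 a0 Eb Ea.
rewrite -lnM ?posrE; try lra; congr ln.
have -> : (s * t + a * b) ^+ 2 - 1 = (s * b + t * a) ^+ 2.
  have -> : (s * t + a * b) ^+ 2 - 1 =
    s ^+ 2 * t ^+ 2 + 2 * s * t * a * b + a ^+ 2 * b ^+ 2 - 1 by ring.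
  have -> : (s * b + t * a) ^+ 2 =
    s ^+ 2 * b ^+ 2 + 2 * s * t * a * b + t ^+ 2 * a ^+ 2 by ring.
  by rewrite Ea Eb; ring.
rewrite sqrtr_sqr ger0_norm; first by ring.
by rewrite addr_ge0// mulr_ge0//; lra.
Qed.

End hyperboloid.

Record hyperbolic_space (R : realType) (N : nat) := Hyperbolic {
  hyp_val :> 'rV[R]_N.+1 ;
  _ : (minkowski hyp_val hyp_val == -1) && (0 < hyp_val 0 0) }.

Section hyperbolic_metric.
Context {R : realType} {N : nat}.

HB.instance Definition _ := [isSub for @hyp_val R N].
HB.instance Definition _ := [Choice of hyperbolic_space R N by <:].

Implicit Types x y z : hyperbolic_space R N.

Definition hyp_dist x y : R := arcosh (- minkowski x y).

Lemma hyp_minkowskixx x : minkowski x x = -1.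
Proof. by case: x => /= x /andP[/eqP]. Qed.

Lemma hyp_time_gt0 x : 0 < (x : 'rV_N.+1) 0 0.
Proof. by case: x => /= x /andP[]. Qed.

Lemma hyp_minkowski_ge1 x y : 1 <= - minkowski x y.
Proof.
have := hyp_minkowskixx x; have := hyp_minkowskixx y.
have := hyp_time_gt0 x; have := hyp_time_gt0 y.
have := spatial_CS x y; have := spatial_ge0 x; have := spatial_ge0 y.
rewrite /minkowski; set a := _ 0 0; set b := _ 0 0.
set p := spatial x x; set q := spatial y y; set s := spatial x y.
move=> q0 p0 spq a0 b0 qE pE.
have {}qE : a * a = q + 1 by lra.
have {}pE : b * b = p + 1 by lra.
rewrite leNgt; apply/negP => H.
have : (b * a) ^+ 2 < (1 + s) ^+ 2.
  by rewrite ltr_pXn2r// ?nnegrE; nra.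
have -> : (b * a) ^+ 2 = (p + 1) * (q + 1) by rewrite -pE -qE; ring.
have : 4 * s ^+ 2 <= (p + q) ^+ 2 by have := sqr_ge0 (p - q); nra.
move=> s4; suff : 2 * s <= p + q by nra.
by rewrite leNgt; apply/negP => ?; nra.
Qed.

Lemma hyp_distxx x : hyp_dist x x = 0.
Proof. by rewrite /hyp_dist hyp_minkowskixx opprK arcosh1. Qed.

Lemma hyp_dist_positivity x y : hyp_dist x y = 0 -> x = y.
Proof.
move=> /(arcosh_eq0 (hyp_minkowski_ge1 x y)) xy.
have {}xy : minkowski x y = -1 by lra.
apply/val_inj/eqP; rewrite /= -subr_eq0 -scaleN1r; apply/eqP.
apply: (@minkowski_orth_eq0 _ _ (y : 'rV_N.+1)).
- exact: hyp_minkowskixx.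
- by rewrite minkowskiDl xy hyp_minkowskixx; ring.
- rewrite minkowskiDl !minkowskiDr !hyp_minkowskixx.
  by rewrite (minkowskiC (y : 'rV_N.+1)) xy; ring.
Qed.

Lemma hyp_dist_sym x y : hyp_dist x y = hyp_dist y x.
Proof. by rewrite /hyp_dist minkowskiC. Qed.

Lemma hyp_dist_triangle y x z : hyp_dist x z <= hyp_dist x y + hyp_dist y z.
Proof.
rewrite /hyp_dist arcoshD ?hyp_minkowski_ge1//.
apply: arcosh_le; first exact: hyp_minkowski_ge1.
have := hyp_minkowski_ge1 x y; have := hyp_minkowski_ge1 y z.
set s := - minkowski x y; set t := - minkowski y z => t1 s1.
have sE : minkowski x y = - s by rewrite opprK.
have tE : minkowski y z = - t by rewrite opprK.
pose u := (x : 'rV[R]_N.+1) + (- s) *: (y : 'rV[R]_N.+1).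
pose v := (z : 'rV[R]_N.+1) + (- t) *: (y : 'rV[R]_N.+1).
have yx : minkowski y x = - s by rewrite minkowskiC.
have zy : minkowski z y = - t by rewrite minkowskiC.
have uu : minkowski u u = s ^+ 2 - 1.
  by rewrite /u minkowskiDl !minkowskiDr !hyp_minkowskixx yx sE; ring.
have vv : minkowski v v = t ^+ 2 - 1.
  by rewrite /v minkowskiDl !minkowskiDr !hyp_minkowskixx tE zy; ring.
have uv : minkowski u v = minkowski x z + s * t.
  by rewrite /u /v minkowskiDl !minkowskiDr hyp_minkowskixx sE tE; ring.
have uy : minkowski u y = 0 by rewrite minkowskiDl hyp_minkowskixx sE; ring.
have vy : minkowski v y = 0 by rewrite minkowskiDl hyp_minkowskixx zy; ring.
have CS : minkowski u v ^+ 2 <= minkowski u u * minkowski v v.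
  apply: discriminant_le => l.
  have := @minkowski_orth_ge0 _ _ y (u + l *: v) (hyp_minkowskixx y).
  rewrite minkowskiDl uy vy mulr0 addr0 => /(_ erefl).
  rewrite (minkowskiDl u v (u + l *: v)) (minkowskiDr u v u) (minkowskiDr u v v).
  by rewrite (minkowskiC v u); congr (0 <= _); ring.
have s2 : 0 <= s ^+ 2 - 1 by nra.
rewrite -lerBlDl -sqrtrM//; apply: le_trans (ler_norm _) _.
rewrite -sqrtr_sqr ler_wsqrtr// -uu -vv; apply: le_trans CS.
have -> : - minkowski x z - s * t = - minkowski u v by rewrite uv; ring.
by rewrite sqrrN.
Qed.

HB.instance Definition _ := isMetric.Build R (hyperbolic_space R N)
  hyp_distxx hyp_dist_positivity hyp_dist_sym hyp_dist_triangle.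

End hyperbolic_metric.

Section asymptotic_cone.
Context {R : realType} (X : nat -> metricType R) (o : forall k, X k).
Variables (w : set_system nat) (Uw : UltraFilter w).

(** The limit along w is taken in the extended reals, where it always exists. *)
Record cone_seq := ConeSeq {
  cone_seq_val :> forall k, X k ;
  _ : `[< (lim ((mdist (cone_seq_val k) (o k))%:E @[k --> w]) < +oo)%E >] }.

HB.instance Definition _ := [isSub for cone_seq_val].
HB.instance Definition _ := [Choice of cone_seq by <:].

Definition cone_seq_dist (x y : cone_seq) : R :=
  lim (mdist (x k) (y k) @[k --> w]).

Lemma ultra_bounded_cvg (u : nat -> R) (M : R) :
  (\forall k \near w, 0 <= u k <= M) -> cvg (u k @[k --> w]).
Proof.
move=> uM; have [x [_ xu]] : `[0, M] `&` [set p | u @ w --> p] !=set0.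
  have UF : UltraFilter (u @ w).
    split; first exact: fmap_proper_filter.
    move=> G PG uG; apply/seteqP; split=> [A GA|]//.
    have [//|uA] := in_ultra_setVsetC (u @^-1` A) Uw.
    have : G (A `&` ~` A) by apply: filterI => //; exact: (uG (~` A)).
    by rewrite setICr => /filter_not_empty.
  have := @segment_compact R 0 M; rewrite compact_ultra.
  move=> /(_ (u @ w) UF); apply; apply: (@filterS _ w _ _ _ _ uM) => k /=.
  by rewrite in_itv.
by apply/cvg_ex; exists x.
Qed.

Lemma cone_seq_bounded (x : cone_seq) :
  exists M : R, \forall k \near w, mdist (x k) (o k) <= M.
Proof.
case: x => x /= /asboolP xoo; apply: contrapT => /forallNP H.
suff E : lim ((mdist (x k) (o k))%:E @[k --> w]) = +oo%E by rewrite E ltxx in xoo.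
apply/cvg_lim => //; apply/cvgeyPge => A.
have [|] := in_ultra_setVsetC [set k | mdist (x k) (o k) <= A] Uw.
  by move/H.
by apply: filterS => k /= /negP; rewrite -ltNge lee_fin => /ltW.
Qed.

Lemma cvg_cone_seq_dist (x y : cone_seq) :
  mdist (x k) (y k) @[k --> w] --> cone_seq_dist x y.
Proof.
have [M xM] := cone_seq_bounded x; have [P yP] := cone_seq_bounded y.
apply: (@ultra_bounded_cvg _ (M + P)); near=> k.
rewrite mdist_ge0/= (le_trans (metric_triangle _ (o k) _))//.
by rewrite lerD//; [near: k|rewrite metric_sym; near: k].
Unshelve. all: by end_near. Qed.

Lemma cone_seq_distxx x : cone_seq_dist x x = 0.
Proof.
apply/cvg_lim => //; under eq_fun do rewrite mdistxx; exact: cvg_cst.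
Qed.

Lemma cone_seq_dist_sym x y : cone_seq_dist x y = cone_seq_dist y x.
Proof. by congr (lim (_ @ w)); apply/funext => k; rewrite metric_sym. Qed.

Lemma cone_seq_dist_ge0 x y : 0 <= cone_seq_dist x y.
Proof.
apply: limr_ge; first exact: cvg_cone_seq_dist.
by apply: nearW => k; exact: mdist_ge0.
Qed.

Lemma cone_seq_dist_triangle y x z :
  cone_seq_dist x z <= cone_seq_dist x y + cone_seq_dist y z.
Proof.
apply: (ler_cvg_to (@cvg_cone_seq_dist x z)
  (cvgD (@cvg_cone_seq_dist x y) (@cvg_cone_seq_dist y z))).
by apply: nearW => k; exact: metric_triangle.
Qed.

Definition cone_eqv (x y : cone_seq) : bool := cone_seq_dist x y == 0.

Lemma cone_eqv_refl : reflexive cone_eqv.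
Proof. by move=> x; rewrite /cone_eqv cone_seq_distxx. Qed.

Lemma cone_eqv_sym : symmetric cone_eqv.
Proof. by move=> x y; rewrite /cone_eqv cone_seq_dist_sym. Qed.

Lemma cone_eqv_trans : transitive cone_eqv.
Proof.
move=> y x z /eqP xy /eqP yz; rewrite /cone_eqv eq_le cone_seq_dist_ge0 andbT.
by rewrite (le_trans (cone_seq_dist_triangle y x z))// xy yz addr0.
Qed.

Canonical cone_equiv :=
  EquivRel cone_eqv cone_eqv_refl cone_eqv_sym cone_eqv_trans.

(** The asymptotic cone of the pointed metric spaces (X k, o k) along w. *)
Definition asymptotic_cone : Type := {eq_quot cone_equiv}.

HB.instance Definition _ := Choice.on asymptotic_cone.
HB.instance Definition _ := EqQuotient.on asymptotic_cone.

Definition cone_dist (p q : asymptotic_cone) : R :=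
  cone_seq_dist (repr p) (repr q).

Lemma cone_dist_pi (x y : cone_seq) :
  cone_dist (\pi_asymptotic_cone x) (\pi_asymptotic_cone y) =
  cone_seq_dist x y.
Proof.
have E z : cone_seq_dist (repr (\pi_asymptotic_cone z)) z = 0.
  by apply/eqP; rewrite -/(cone_eqv _ z); apply/eqmodP; rewrite reprK.
rewrite /cone_dist; set x' := repr _; set y' := repr _.
have Ex : cone_seq_dist x' x = 0 := E x.
have Ey : cone_seq_dist y' y = 0 := E y.
have Ex' := cone_seq_dist_sym x x'; have Ey' := cone_seq_dist_sym y y'.
have := cone_seq_dist_triangle x x' y'; have := cone_seq_dist_triangle y x y'.
have := cone_seq_dist_triangle x' x y; have := cone_seq_dist_triangle y' x' y.
by move=> *; apply/eqP; rewrite eq_le; apply/andP; split; lra.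
Qed.

Lemma cone_distxx p : cone_dist p p = 0.
Proof. exact: cone_seq_distxx. Qed.

Lemma cone_dist_positivity p q : cone_dist p q = 0 -> p = q.
Proof.
by move=> /eqP pq; rewrite -(reprK p) -(reprK q); apply/eqmodP.
Qed.

Lemma cone_dist_sym p q : cone_dist p q = cone_dist q p.
Proof. exact: cone_seq_dist_sym. Qed.

Lemma cone_dist_triangle q p s :
  cone_dist p s <= cone_dist p q + cone_dist q s.
Proof. exact: cone_seq_dist_triangle. Qed.

HB.instance Definition _ := isMetric.Build R asymptotic_cone
  cone_distxx cone_dist_positivity cone_dist_sym cone_dist_triangle.

End asymptotic_cone.

(* Main.v *)
Require Import Defs.
From mathcomp Require Import all_boot all_order all_algebra.
From mathcomp Require Import generic_quotient ring lra.
From mathcomp Require Import all_classical all_reals all_analysis.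
Import Order.TTheory GRing.Theory Num.Theory.
Import numFieldNormedType.Exports.
Local Open Scope classical_set_scope.
Local Open Scope ring_scope.
Local Open Scope quotient_scope.

(** Properness separates the hyperbolic spaces from their asymptotic cone.
    A bounded sequence in [H^N] always has two terms that are arbitrarily close
    to each other ([hyp_bounded_seq_close]): its coordinates in Minkowski space
    are bounded, and [- <x, y> = 1 + <x - y, x - y> / 2] turns closeness of
    coordinates into closeness in [H^N].  The cone, on the contrary, contains
    an infinite set of points at pairwise distances between 1 and 3
    ([cone_scattered_seq]).  To see this, parametrize a horocycle through [o_k]
    by arc length; its chords satisfy [cosh d = 1 + (s - t)^2 / 2], so that the
    points of parameters [i exp(r_k)], for natural numbers [i], lie at distance
    [2 r_k + O(1)] from each other, with a bound that depends on [i] and [j]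
    but not on [k].

    If the images in [Y] converge in the Hausdorff sense, then for some [k] every
    point of [f(X_w)] is within 1/4 of [f_k(X_k)].  Replacing the scattered
    points of the cone by nearby points of [X_k] changes their distances by at
    most 1/2, and gives a bounded infinite sequence in one rescaled hyperbolic
    space with all mutual distances at least 1/2, which is impossible. *)

(* The Minkowski form, not the integral inequality of that name. *)
Local Notation minkowski := Defs.minkowski.

(** * The function arcosh *)

Section arcosh_bounds.
Context {R : realType}.

Lemma ln_le_arcosh (t : R) : 1 <= t -> ln t <= arcosh t.
Proof.
move=> t1; have := sqrtr_ge0 (t ^+ 2 - 1) => s0.
by rewrite /arcosh ler_ln ?posrE; lra.
Qed.

Lemma arcosh_le_ln2 (t : R) : 1 <= t -> arcosh t <= ln (2 * t).
Proof.
move=> t1; have s0 := sqrtr_ge0 (t ^+ 2 - 1).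
have st : Num.sqrt (t ^+ 2 - 1) <= t.
  rewrite -[leRHS]gtr0_norm; last by lra.
  by rewrite -sqrtr_sqr ler_wsqrtr//; lra.
by rewrite /arcosh ler_ln ?posrE; lra.
Qed.

Lemma arcosh_cosh (e : R) : 1 <= e -> arcosh ((e + e^-1) / 2) = ln e.
Proof.
move=> e1; have e0 : e != 0 by apply: lt0r_neq0; lra.
have ei : e^-1 <= 1 by rewrite invf_le1; lra.
rewrite /arcosh.
have -> : ((e + e^-1) / 2) ^+ 2 - 1 = ((e - e^-1) / 2) ^+ 2 by field.
by rewrite sqrtr_sqr ger0_norm; [congr ln; field|lra].
Qed.

End arcosh_bounds.

(** * Bounded sequences of real vectors *)

Section pigeonhole.
Context {R : realType}.

(** Cut the box [-B, B]^I into finitely many cells of side [delta] and use the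
    pigeonhole principle. *)
Lemma bounded_seq_close (I : finType) (z : nat -> I -> R) (B delta : R) :
  0 < delta -> (forall n i, `|z n i| <= B) ->
  exists m n, m != n /\ forall i, `|z m i - z n i| <= delta.
Proof.
move=> d0 zB; pose K := Num.truncn (2 * B / delta).
pose cell n i := Num.truncn ((z n i + B) / delta).
have z0 n i : 0 <= (z n i + B) / delta.
  apply: divr_ge0; last exact: ltW.
  by have := zB n i; rewrite ler_norml => /andP[]; lra.
have cellK n i : (cell n i < K.+1)%N.
  rewrite ltnS; apply: le_truncn; rewrite ler_pM2r ?invr_gt0//.
  by have := zB n i; rewrite ler_norml => /andP[]; lra.
pose box (n : 'I_#|{ffun I -> 'I_K.+1}|.+1) := [ffun i => Ordinal (cellK n i)].
have /injectivePn[m [n mn boxE]] : ~~ injectiveb box.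
  apply/negP => /injectiveP/leq_card; rewrite card_ord => h.
  by move: h; rewrite ltnn.
exists (val m), (val n); split => [|i]; first by rewrite (inj_eq val_inj).
have : cell m i = cell n i.
  by move/ffunP/(_ i): boxE; rewrite !ffunE => /(congr1 val).
have := truncn_itv (z0 m i); have := truncn_itv (z0 n i).
rewrite /cell => /andP[+ +] /andP[+ +] E; rewrite E.
set a := (_ / _); set b := (z m i + B) / delta; set q := (_%:R).
rewrite -natr1 -/q => qa aq qb bq.
have -> : z m i - z n i = (b - a) * delta by rewrite /a /b; field; exact: lt0r_neq0.
rewrite normrM (gtr0_norm d0) -[leRHS]mul1r ler_pM2r// ler_norml.
by apply/andP; split; lra.
Qed.

End pigeonhole.

(** * Bounded sequences and horocycles in hyperbolic space *)

Section hyperbolic_geometry.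
Context {R : realType} {N : nat}.
Implicit Types x y o : hyperbolic_space R N.

Lemma spatial_coord_le (x : 'rV[R]_N.+1) (i : 'I_N) :
  x 0 (lift ord0 i) ^+ 2 <= spatial x x.
Proof.
rewrite /spatial (bigD1 i)//= -expr2 lerDl sumr_ge0// => j _.
by rewrite -expr2 sqr_ge0.
Qed.

Lemma spatial_le (x : 'rV[R]_N.+1) (delta : R) :
  (forall i, `|x 0 (lift ord0 i)| <= delta) -> spatial x x <= N%:R * delta ^+ 2.
Proof.
move=> xd; apply: (@le_trans _ _ (\sum_(i < N) delta ^+ 2)).
  apply: ler_sum => i _; rewrite -expr2 -real_normK ?num_real//.
  by rewrite lerXn2r ?nnegrE// (le_trans _ (xd i)).
by rewrite sumr_const card_ord mulr_natl.
Qed.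

Lemma minkowski_time (x : 'rV[R]_N.+1) : minkowski (delta_mx 0 ord0) x = - x 0 0.
Proof.
rewrite /minkowski /spatial big1 => [|i _]; last by rewrite !mxE/= mul0r.
by rewrite !mxE/= mul1r sub0r.
Qed.

Lemma minkowski_space (i : 'I_N) (x : 'rV[R]_N.+1) :
  minkowski (delta_mx 0 (lift ord0 i)) x = x 0 (lift ord0 i).
Proof.
rewrite /minkowski /spatial (bigD1 i)//= big1 => [|j ji].
  by rewrite !mxE/= !eqxx/= mul1r mul0r addr0 subr0.
by rewrite !mxE/= (inj_eq (@lift_inj _ _)) (negbTE ji) mul0r.
Qed.

Lemma hyp_coord_bound (i : 'I_N) x :
  `|(x : 'rV[R]_N.+1) 0 (lift ord0 i)| <= (x : 'rV[R]_N.+1) 0 0.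
Proof.
have := spatial_coord_le x i; have := hyp_minkowskixx x; have := hyp_time_gt0 x.
rewrite /minkowski; set t := _ 0 0; set z := _ 0 (lift _ _) => t0 E zs.
rewrite -(@ler_pXn2r _ 2)// ?nnegrE ?normr_ge0 ?ltW//.
rewrite real_normK ?num_real//; nra.
Qed.

Lemma hyp_apex_subproof :
  (minkowski (delta_mx 0 ord0 : 'rV[R]_N.+1) (delta_mx 0 ord0) == -1) &&
  (0 < (delta_mx 0 ord0 : 'rV[R]_N.+1) 0 0).
Proof. by rewrite minkowski_time !mxE !eqxx/= ltr01. Qed.

Definition hyp_apex : hyperbolic_space R N := Hyperbolic hyp_apex_subproof.

(** The time coordinate is the hyperbolic cosine of the distance to the apex. *)
Lemma hyp_time_le_exp x :
  (x : 'rV[R]_N.+1) 0 0 <= expR (hyp_dist hyp_apex x).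
Proof.
have := hyp_minkowski_ge1 hyp_apex x; rewrite /hyp_dist /= minkowski_time opprK.
by move=> t1; rewrite -ler_ln ?posrE ?expR_gt0 ?expRK ?ln_le_arcosh//; lra.
Qed.

(** Since [x] and [y] have Minkowski square -1, [- <x, y>] is
    [1 + <x - y, x - y> / 2], and the time component of [x - y] only decreases
    its Minkowski square. *)
Lemma minkowski_close x y (delta : R) :
  (forall i, `|(x : 'rV[R]_N.+1) 0 (lift ord0 i) -
               (y : 'rV[R]_N.+1) 0 (lift ord0 i)| <= delta) ->
  - minkowski x y <= 1 + N%:R * delta ^+ 2 / 2.
Proof.
move=> xy; pose u := (x : 'rV[R]_N.+1) + (-1) *: (y : 'rV[R]_N.+1).
have uu : minkowski u u = - 2 - 2 * minkowski x y.
  rewrite /u minkowskiDl !minkowskiDr !hyp_minkowskixx.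
  by rewrite (minkowskiC (y : 'rV_N.+1)); ring.
have : spatial u u <= N%:R * delta ^+ 2.
  by apply: spatial_le => i; rewrite !mxE mulN1r.
have : minkowski u u <= spatial u u by rewrite /minkowski lerBlDr lerDl -expr2 sqr_ge0.
rewrite uu; lra.
Qed.

(** Total boundedness of balls in [H^N], stated for sequences: a distance at
    most [D] from the first term bounds all coordinates, so two terms have close
    coordinates. *)
Lemma hyp_bounded_seq_close (x : nat -> hyperbolic_space R N) (c D : R) :
  0 < c -> (forall n, hyp_dist (x 0%N) (x n) <= D) ->
  exists m n, m != n /\ hyp_dist (x m) (x n) <= c.
Proof.
move=> c0 xD; have e1 : 1 < expR c by rewrite expR_gt1.
(* [t] is cosh c, and [eta] is chosen so that 1 + N eta / 2 <= t. *)
pose t := (expR c + (expR c)^-1) / 2.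
have t1 : 0 < t - 1.
  have -> : t - 1 = (expR c - 1) ^+ 2 / (2 * expR c).
    by rewrite /t; field; exact/lt0r_neq0/expR_gt0.
  by rewrite divr_gt0 ?exprn_gt0 ?mulr_gt0 ?expR_gt0// subr_gt0.
pose eta := 2 * (t - 1) / N.+1%:R.
have eta0 : 0 < eta by rewrite !divr_gt0// mulr_gt0.
have [|n i|m [n [mn close]]] := @bounded_seq_close _ _
    (fun n i => (x n : 'rV[R]_N.+1) 0 (lift ord0 i))
    (expR (hyp_dist hyp_apex (x 0%N) + D)) (Num.sqrt eta) _.
- by rewrite sqrtr_gt0.
- apply: le_trans (hyp_coord_bound _ _) _; apply: le_trans (hyp_time_le_exp _) _.
  by rewrite ler_expR (le_trans (hyp_dist_triangle (x 0%N) _ _))// lerD2l.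
exists m, n; split => //.
rewrite -[c]expRK -(arcosh_cosh _ (ltW e1)); apply: arcosh_le.
  exact: hyp_minkowski_ge1.
apply: le_trans (minkowski_close _ _ _ close) _; rewrite -/t (sqr_sqrtr (ltW eta0)).
have -> : N%:R * eta / 2 = (t - 1) * (N%:R / N.+1%:R).
  by rewrite /eta; field.
have : N%:R / N.+1%:R <= 1 :> R by rewrite ler_pdivrMr// mul1r ler_nat.
have : 0 <= N%:R / N.+1%:R :> R by rewrite divr_ge0.
set q := _ / _; nra.
Qed.

(** By Cauchy-Schwarz, [|spatial p o| < |p_0| o_0], so the sign of [<p, o>] is
    opposite to that of [p_0]. *)
Lemma timelike_same_sheet o (p : 'rV[R]_N.+1) :
  minkowski p p = -1 -> minkowski p o < 0 -> 0 < p 0 0.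
Proof.
have := spatial_CS p o; have := hyp_minkowskixx o; have := hyp_time_gt0 o.
have := spatial_ge0 o; have := spatial_ge0 p; rewrite /minkowski.
set a := _ 0 0; set b := p 0 0.
set s := spatial p o; set u := spatial p p; set v := spatial o o.
move=> u0 v0 a0 vE CS uE po; rewrite ltNge; apply/negP => b0.
have {}uE : u = b * b - 1 by lra.
have {}vE : v = a * a - 1 by lra.
have : (- s) ^+ 2 < (b * a) ^+ 2.
  rewrite sqrrN; apply: (le_lt_trans CS); rewrite uE vE; nra.
have ba : 0 <= - (b * a) by nra.
rewrite -(sqrrN (b * a)).
have : - (b * a) < - s by lra.
move=> lt1; apply/negP; rewrite -leNgt lerXn2r ?nnegrE//; lra.
Qed.

(** The null vector [l] is a point at infinity of [H^N], and [v] a unit vector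
    tangent at [o] to the horosphere through [o] centred at [l].  Such a [v]
    exists only from dimension 2 on: on a line, horospheres are points. *)
Lemma exists_null_frame o : (1 < N)%N -> exists l v : 'rV[R]_N.+1,
  [/\ minkowski l l = 0, minkowski l o = -1, minkowski v l = 0,
      minkowski v o = 0 & minkowski v v = 1].
Proof.
move=> N1; pose i1 : 'I_N := Ordinal (ltnW N1); pose i2 : 'I_N := Ordinal N1.
pose a := (o : 'rV[R]_N.+1) 0 0; pose b := (o : 'rV[R]_N.+1) 0 (lift ord0 i1).
pose b2 := (o : 'rV[R]_N.+1) 0 (lift ord0 i2).
have ab : a - b != 0.
  apply: lt0r_neq0; have := spatial_coord_le o i1; have := hyp_minkowskixx o.
  have := hyp_time_gt0 o; rewrite /minkowski -/a -/b; nra.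
(* [n] is the null vector in the direction of the first axis, and [l] is the
   multiple of [n] with [<l, o> = -1].  The second axis [e2] is orthogonal to
   [l], hence so is [e2 + b2 l]; adding [b2 l] makes it orthogonal to [o] as
   well, without affecting its square. *)
pose e1 : 'rV[R]_N.+1 := delta_mx 0 (lift ord0 i1).
pose e2 : 'rV[R]_N.+1 := delta_mx 0 (lift ord0 i2).
pose n : 'rV[R]_N.+1 := delta_mx 0 ord0 + 1 *: e1.
pose l : 'rV[R]_N.+1 := 0 + (a - b)^-1 *: n.
have m0 (x : 'rV[R]_N.+1) : minkowski 0 x = 0.
  by have := minkowskiDl 0 0 x (-1); rewrite scaler0 addr0; lra.
have lE (y : 'rV[R]_N.+1) :
    minkowski l y = (a - b)^-1 * (y 0 (lift ord0 i1) - y 0 0).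
  rewrite /l minkowskiDl m0 add0r /n minkowskiDl minkowski_time minkowski_space.
  by ring.
have lo : minkowski l o = -1 by rewrite lE -/a -/b; field.
have ll : minkowski l l = 0.
  by rewrite lE /l /n /e1 !mxE/=; ring.
have e2l : minkowski e2 l = 0.
  by rewrite minkowskiC lE /e2 !mxE/=; ring.
have e2o : minkowski e2 o = b2 by rewrite minkowski_space.
have e22 : minkowski e2 e2 = 1 by rewrite minkowski_space !mxE !eqxx.
clearbody l; exists l, (e2 + b2 *: l); split => //.
- by rewrite minkowskiDl ll e2l; ring.
- by rewrite minkowskiDl lo e2o; ring.
- rewrite minkowskiDl !minkowskiDr ll (minkowskiC l e2) e2l e22; ring.
Qed.

(** The curve [o + t v + (t^2 / 2) l] is the horocycle through [o] tangent to
    [v], that is, the orbit of [o] under a one-parameter group of parabolic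
    isometries fixing [l]; this is why [<p s, p t>] depends only on [s - t]. *)
Lemma exists_horocycle o : (1 < N)%N -> exists p : R -> hyperbolic_space R N,
  p 0 = o /\ forall s t, - minkowski (p s) (p t) = 1 + (s - t) ^+ 2 / 2.
Proof.
move=> /(exists_null_frame o)[l [v [ll lo vl vo vv]]].
pose p t := (o : 'rV[R]_N.+1) + t *: v + (t ^+ 2 / 2) *: l.
have pp s t : minkowski (p s) (p t) = - (1 + (s - t) ^+ 2 / 2).
  have [ol ov lv] : [/\ minkowski o l = -1, minkowski o v = 0 &
      minkowski l v = 0] by rewrite !(minkowskiC _ l) !(minkowskiC _ v) lo vo vl.
  rewrite /p !(minkowskiDl, minkowskiDr) hyp_minkowskixx ll lo vl vo vv ol ov lv.
  by field.
have p0 : p 0 = o.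
  by rewrite /p scale0r addr0 expr0n/= mul0r scale0r addr0.
have pH t : (minkowski (p t) (p t) == -1) && (0 < p t 0 0).
  have pt : minkowski (p t) (p t) = -1 by rewrite pp subrr; field.
  rewrite pt eqxx/=; apply: (timelike_same_sheet o) => //.
  by rewrite -p0 pp subr0; have := sqr_ge0 t; lra.
exists (fun t => Hyperbolic (pH t)); split; last by move=> s t /=; rewrite pp opprK.
exact/val_inj.
Qed.

(** The points of the horocycle with parameters [i exp(r)]: the cosh of their
    distances is [1 + (i - j)^2 exp(2 r) / 2], and arcosh is the logarithm up to
    a bounded error.  The errors do not involve [r], so they vanish once
    distances are divided by [r] and [r] tends to infinity. *)
Lemma exists_scattered_seq o (r : R) : (1 < N)%N -> 0 <= r ->
  exists p : nat -> hyperbolic_space R N, p 0%N = o /\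
    forall i j, i != j ->
      2 * r - ln 2 <= hyp_dist (p i) (p j) <=
      2 * r + ln (2 + (i%:R - j%:R) ^+ 2).
Proof.
move=> N1 r0; have [p [p0 pp]] := exists_horocycle o N1.
exists (fun i => p (i%:R * expR r)); split; first by rewrite mul0r.
move=> i j ij; set m := (_ ^+ 2); have m1 : 1 <= m.
  have -> : m = ((i%:Z - j%:Z) ^+ 2)%:~R.
    by rewrite /m rmorphXn rmorphB.
  (* A nonzero square of an integer is at least 1. *)
  by rewrite ler1z -gtz0_ge1 exprn_even_gt0//= subr_eq0 eqz_nat.
have e1 : 1 <= expR r ^+ 2 by rewrite exprn_ege1 // -expR0 ler_expR.
have e2 : ln (expR r ^+ 2) = 2 * r.
  by rewrite lnXn ?expR_gt0// expRK mulr_natl.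
have t1 : 1 <= 1 + m * expR r ^+ 2 / 2 by nra.
have E : hyp_dist (p (i%:R * expR r)) (p (j%:R * expR r)) =
    arcosh (1 + m * expR r ^+ 2 / 2).
  by rewrite /hyp_dist pp -mulrBl exprMn.
rewrite E; apply/andP; split.
  apply: le_trans (ln_le_arcosh _ t1).
  rewrite -e2 -ln_div ?posrE; try lra.
  by rewrite ler_ln ?posrE; nra.
apply: le_trans (arcosh_le_ln2 _ t1) _.
rewrite -e2 -lnM ?posrE; try lra.
by rewrite ler_ln ?posrE; nra.
Qed.

End hyperbolic_geometry.

(** * Ultralimits and the asymptotic cone *)

Section ultralimits.

(** Otherwise the ultrafilter would contain a finite set, hence a singleton, and
    would be principal. *)
Lemma nonprincipal_cofinite (w : set_system nat) (Uw : UltraFilter w) :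
  (forall n, w <> principal_filter n) -> \oo `<=` w.
Proof.
move=> wn A [n _ nA].
have [//|wA] := in_ultra_setVsetC A Uw; exfalso.
have : w [set k | (k < n)%N].
  apply: filterS wA => k /= kA; rewrite ltnNge; apply/negP => nk.
  by apply: kA; exact: nA.
elim: n {nA wA} => [|n IH] wlt.
  by apply: (@filter_not_empty _ w); apply: filterS wlt.
have [wS|wC] := in_ultra_setVsetC [set n] Uw.
  apply: (wn n); apply/seteqP; split => B.
    move=> wB; apply/principal_filterP; apply: contrapT => nB.
    apply: (@filter_not_empty _ w).
    by apply: filterS (filterI wB wS) => k [Bk kn]; apply: nB; rewrite -kn.
  by move=> /principal_filterP Bn; apply: filterS wS => k ->.
apply: IH; apply: filterS (filterI wlt wC) => k [/= kn /eqP nk].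
by rewrite ltn_neqAle nk -ltnS.
Qed.

Context {R : realType} (X : nat -> metricType R) (o : forall k, X k).
Variables (w : set_system nat) (Uw : UltraFilter w).

Lemma cone_seqP (x : forall k, X k) (M : R) :
  (\forall k \near w, mdist (x k) (o k) <= M) ->
  `[< (lim ((mdist (x k) (o k))%:E @[k --> w]) < +oo)%E >].
Proof.
move=> xM; apply/asboolP.
have /cvg_ex[l xl] : cvg (mdist (x k) (o k) @[k --> w]).
  by apply: (@ultra_bounded_cvg _ _ _ _ M); apply: filterS xM => k ->; rewrite mdist_ge0.
suff -> : lim ((mdist (x k) (o k))%:E @[k --> w]) = l%:E by rewrite ltry.
apply/cvg_lim => //; apply: cvg_EFin => //.
by apply: nearW.
Qed.

Lemma cone_dist_between (x y : cone_seq o w) (a b : R) :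
  (\forall k \near w, a <= mdist (x k) (y k) <= b) ->
  a <= mdist (\pi_(asymptotic_cone o Uw) x : asymptotic_cone o Uw)
             (\pi_(asymptotic_cone o Uw) y) <= b.
Proof.
move=> xy; rewrite [mdist _ _]cone_dist_pi /cone_seq_dist.
have cv := @cvg_cone_seq_dist R X o w Uw x y.
apply/andP; split; [apply: limr_ge|apply: limr_le] => //;
  try (by apply/cvg_ex; exists (cone_seq_dist x y)).
- by apply: filterS xy => k /andP[].
- by apply: filterS xy => k /andP[].
Qed.

End ultralimits.

(** * Hausdorff distance and the main result *)

Section hausdorff.
Context {R : realType}.

Lemma hausdorff_dist_approx (Y : metricType R) (A B : set Y) (e : R) :
  (hausdorff_dist A B < e%:E)%E -> forall b, B b -> exists2 a, A a & mdist b a < e.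
Proof.
move=> ABe b Bb; have : (dist_to_set A b < e%:E)%E.
  apply: le_lt_trans ABe; rewrite /hausdorff_dist le_max; apply/orP; right.
  by apply: ereal_sup_ubound; exists b.
by move=> /ereal_inf_lt[_ [a Aa <-]]; rewrite lte_fin => ba; exists a.
Qed.

End hausdorff.

(** The classes of the scattered sequences based at [o_k].  The distances of
    their terms, divided by [r_k], tend to 2; bounds by 1 and 3 are enough, and
    they hold as soon as [r_k] exceeds the two logarithmic errors. *)
Lemma cone_scattered_seq (R : realType) (N : nat) (N_gt1 : (1 < N)%N)
    (r : nat -> {posnum R}) (r_infty : (r k)%:num @[k --> \oo] --> +oo)
    (o : nat -> hyperbolic_space R N)
    (w : set_system nat) (Uw : UltraFilter w)
    (w_nonprincipal : forall n : nat, w <> principal_filter n) :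
  let X (k : nat) : metricType R :=
    rescaled ((r k)%:num^-1)%:pos (hyperbolic_space R N) in
  let Xw : metricType R := asymptotic_cone (X := X) o Uw in
  exists x : nat -> Xw, forall i j, i != j -> 1 <= mdist (x i) (x j) <= 3.
Proof.
move=> X Xw.
have r_large A : \forall k \near w, A <= (r k)%:num.
  by apply: nonprincipal_cofinite => //; move/cvgryPge : r_infty; apply.
have [p pP] := choice (fun k =>
  @exists_scattered_seq R N (o k) (r k)%:num N_gt1 (ltW (gt0 (r k)))).
have pX i j : i != j -> \forall k \near w,
    1 <= mdist (p k i : X k) (p k j : X k) <= 3.
  move=> ij; near=> k.
  have [_ /(_ i j ij)] := pP k.
  have -> : mdist (p k i : X k) (p k j : X k) =
    (r k)%:num^-1 * hyp_dist (p k i) (p k j) by [].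
  rewrite [_^-1 * _]mulrC ler_pdivlMr// ler_pdivrMr// mul1r.
  have : ln 2 <= (r k)%:num by near: k; exact: r_large.
  have : ln (2 + (i%:R - j%:R) ^+ 2) <= (r k)%:num by near: k; exact: r_large.
  by move=> h1 h2 /andP[h3 h4]; apply/andP; split; lra.
have pc i : `[< (lim ((mdist (p k i : X k) (o k : X k))%:E @[k --> w]) < +oo)%E >].
  apply: (@cone_seqP _ X o w Uw _ 3).
  have [->|i0] := eqVneq i 0%N.
    by apply: nearW => k; case: (pP k) => -> _; rewrite mdistxx.
  by apply: filterS (pX _ _ i0) => k /andP[_]; case: (pP k) => ->.
exists (fun i => \pi_Xw (ConeSeq (pc i))) => i j ij.
exact: (@cone_dist_between _ X o w Uw (ConeSeq (pc i)) (ConeSeq (pc j)) _ _ (pX i j ij)).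
Unshelve. all: by end_near. Qed.

Theorem proposition1p9 (R : realType) (N : nat) (N_gt1 : (1 < N)%N)
    (r : nat -> {posnum R}) (r_infty : (r k)%:num @[k --> \oo] --> +oo)
    (o : nat -> hyperbolic_space R N)
    (w : set_system nat) (Uw : UltraFilter w)
    (w_nonprincipal : forall n : nat, w <> principal_filter n) :
  let X (k : nat) : metricType R :=
    rescaled ((r k)%:num^-1)%:pos (hyperbolic_space R N) in
  let Xw : metricType R := asymptotic_cone (X := X) o Uw in
  ~ exists (Y : metricType R) (f_ : forall k : nat, X k -> Y) (f : Xw -> Y),
      [/\ forall k : nat, isometric_embedding (f_ k),
          isometric_embedding f,
          forall x : cone_seq (X := X) o w,
            f_ k (x k) @[k --> w] --> f (\pi_Xw x) &
          hausdorff_dist (range (f_ k)) (range f) @[k --> w] --> 0%E].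
Proof.
move=> X Xw [Y [f_ [f [f_iso fiso _ fH]]]].
have [x xP] := @cone_scattered_seq R N N_gt1 r r_infty o w Uw w_nonprincipal.
have /filter_ex[k Hk] :
    \forall k \near w, (hausdorff_dist (range (f_ k)) (range f) < (1 / 4)%:E)%E.
  apply: (fH [set u | (u < (1 / 4)%:E)%E]).
  by apply: open_ereal_lt'; rewrite lte_fin; lra.
have /choice[y yP] i : exists z : X k, mdist (f (x i)) (f_ k z) < 1 / 4.
  have [_ [z _ <-] zi] := hausdorff_dist_approx _ _ _ _ Hk (f (x i))
    (ex_intro2 _ _ (x i) I erefl).
  by exists z.
have yy i j : i != j -> 1 / 2 <= mdist (y i) (y j) <= 4.
  move=> /xP/andP[]; rewrite -(fiso (x i)) -(f_iso k (y i)).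
  have := yP i; have := yP j.
  have := metric_triangle (f (x i)) (f_ k (y i)) (f (x j)).
  have := metric_triangle (f_ k (y i)) (f_ k (y j)) (f (x j)).
  have := metric_triangle (f_ k (y i)) (f (x i)) (f_ k (y j)).
  have := metric_triangle (f (x i)) (f (x j)) (f_ k (y j)).
  rewrite (metric_sym (f_ k (y i)) (f (x i))) (metric_sym (f_ k (y j)) (f (x j))).
  by move=> *; apply/andP; split; lra.
have r0 : 0 < (r k)%:num by [].
have yE i j : mdist (y i) (y j) = (r k)%:num^-1 * hyp_dist (y i) (y j) by [].
have [||m [n [mn]]] := @hyp_bounded_seq_close R N y ((r k)%:num / 4) (4 * (r k)%:num).
- by rewrite divr_gt0.
- move=> n; have [<-|n0] := eqVneq 0%N n; first by rewrite hyp_distxx mulr_ge0.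
  by have /andP[_] := yy _ _ n0; rewrite yE mulrC ler_pdivrMr.
have /andP[+ _] := yy _ _ mn; rewrite yE [_^-1 * _]mulrC ler_pdivlMr//. lra.
Qed.
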